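(* Let $V$ be a finite-dimensional diffeological vector space, and let $V^*$ be its diffeological dual. Then the functional diffeology on $V^*$ is standard, i.e., $V^*$ is diffeomorphic (as a diffeological vector space) to $\mathbb{R}^k$ with its standard diffeology, for the appropriate $k$.
   Context: A diffeology on a set $X$ is a collection of maps $U\to X$ (plots), $U$ ranging over open subsets of $\mathbb{R}^m$, $m\in\mathbb{N}$, such that: all constant maps are plots; if $p:U\to X$ is a plot and $h:U'\to U$ is an ordinary smooth map from an open set $U'$ of a Euclidean space, then $p\circ h$ is a plot; a map $U\to X$ that restricts to a plot on each member of an open cover of $U$ is a plot. A map between diffeological spaces is smooth if its composition with each plot of the source is a plot of the target; a diffeomorphism is a smooth bijection with smooth inverse. The product $X_1\times X_2$ has the product diffeology: a map $U\to X_1\times X_2$ is a plot iff both of its components are plots. The standard diffeology on $\mathbb{R}^k$ consists of all ordinary smooth maps into $\mathbb{R}^k$. A diffeological vector space is a real vector space $V$ with a diffeology for which addition $V\times V\to V$ and scalar multiplication $\mathbb{R}\times V\to V$ are smooth ($\mathbb{R}$ standard). The diffeological dual $V^*$ is the vector space of all smooth linear functionals $V\to\mathbb{R}$ ($\mathbb{R}$ standard), endowed with the functional diffeology: a map $q:U\to V^*$ is a plot iff for every plot $p:U'\to V$ of $V$ the map $U\times U'\to\mathbb{R}$, $(u,u')\mapsto q(u)(p(u'))$, is smooth in the usual sense. *)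

(* Defs.v *)
From HB Require Import structures.
From mathcomp Require Import all_boot all_order all_algebra.
From mathcomp Require Import boolp classical_sets functions reals topology.
From mathcomp Require Import normedtype landau derive.

Set Implicit Arguments.
Unset Strict Implicit.
Unset Printing Implicit Defensive.

Import Order.TTheory GRing.Theory Num.Theory.
Import numFieldNormedType.Exports.

Local Open Scope classical_set_scope.
Local Open Scope ring_scope.

Section Smooth.
Context {R : realType}.

(* [Ck n U f]: f is n times (Frechet) differentiable on U, with continuous
   derivatives of order at most n. The derivative of f is accessed through the
   directional derivatives 'D_v f, for all vectors v. A map defined on U is
   represented by a total function, of which only the values on U matter when
   U is open (lemma [Ck_ext]). *)
Fixpoint Ck (n m : nat) (F : normedModType R) (U : set 'rV[R]_m)
    (f : 'rV[R]_m -> F) : Prop :=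
  if n is n'.+1 then
    (forall x, U x -> differentiable f x) /\ (forall v, Ck n' U ('D_v f))
  else forall x, U x -> {for x, continuous f}.

Definition smooth_on (m : nat) (F : normedModType R) (U : set 'rV[R]_m)
    (f : 'rV[R]_m -> F) : Prop := forall n, Ck n U f.

Lemma differentiable_near0 (E F : normedModType R) (f : E -> F) x :
  (\near x, f x = 0) -> differentiable f x.
Proof.
move=> f0.
have fx0 : f x = 0 by exact: (nbhs_singleton f0).
have df : f \o shift x = cst (f x) + (\0 : {linear E -> F}) +o_ (0 : E) id.
  apply/eqaddoP => e e0; rewrite fx0.
  have : \forall h \near (0 : E), f (h + x) = 0.
    by move: f0; rewrite (near_shift 0) /= => f0; apply: filterS f0 => h /=;
      rewrite subr0.
  apply: filterS => h /= fh.
  by rewrite !fctE /= fh addr0 subrr normr0 mulr_ge0 // ltW.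
have c0 : continuous (\0 : {linear E -> F}).
  by move=> y; apply: cvg_cst.
by apply/diff_locallyP; rewrite (diff_unique c0 df).
Qed.

Lemma differentiable_near_eq (E F : normedModType R) (f g : E -> F) x :
  (\near x, f x = g x) -> differentiable f x -> differentiable g x.
Proof.
move=> fg df; have -> : g = f + (g - f) by rewrite addrC subrK.
apply: differentiableD => //; apply: differentiable_near0.
by apply: filterS fg => y fgy; rewrite !fctE /= fgy subrr.
Qed.

Section theory.
Variable m : nat.
Implicit Types (F : normedModType R) (U : set 'rV[R]_m).

Lemma Ck_ext n F U (f g : 'rV[R]_m -> F) : open U ->
  (forall x, U x -> f x = g x) -> Ck n U f -> Ck n U g.
Proof.
move=> oU; have near_fg (f' g' : 'rV[R]_m -> F) x :
    (forall x, U x -> f' x = g' x) -> U x -> \near x, f' x = g' x.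
  by move=> fg Ux; apply: filterS (open_nbhs_nbhs (conj oU Ux)) => y /fg.
elim: n f g => [|n IHn] f g fg /=.
  move=> cf x Ux; have := cf x Ux; rewrite /prop_for /continuous_at fg // => cfx.
  apply: cvg_trans cfx; apply: (@near_eq_cvg _ _ (nbhs x)).
  by apply: near_fg => // y /fg.
case=> df Cf; split=> [x Ux|v].
  by apply: differentiable_near_eq (df x Ux); apply: near_fg.
apply: IHn (Cf v) => x Ux; apply: near_eq_derive; exact: near_fg.
Qed.

Lemma Ck_sub n F U U' (f : 'rV[R]_m -> F) :
  U' `<=` U -> Ck n U f -> Ck n U' f.
Proof.
move=> sU; elim: n f => [|n IHn] f /=; first by move=> cf x /sU /cf.
by case=> df Cf; split=> [x /sU /df //|v]; apply: IHn.
Qed.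

Lemma CkW n F U (f : 'rV[R]_m -> F) : Ck n.+1 U f -> Ck n U f.
Proof.
elim: n f => [|n IHn] f.
  by case=> df _ x Ux; apply: differentiable_continuous; exact: df.
by case=> df Cf; split=> // v; apply: IHn.
Qed.

Lemma Ck_cst n F U (a : F) : Ck n U (cst a).
Proof.
elim: n a => [|n IHn] a; first by move=> x _; exact: cst_continuous.
split=> [x _|v]; first exact: differentiable_cst.
have -> : 'D_v (cst a : 'rV[R]_m -> F) = cst 0.
  by apply/funext => x; rewrite derive_cst.
exact: IHn.
Qed.

Lemma Ck_lin n F U (f : {linear 'rV[R]_m -> F}) : continuous f -> Ck n U f.
Proof.
move=> cf; case: n => [|n]; first by move=> x _; apply: cf.
split=> [x _|v]; first exact: linear_differentiable.
have -> : 'D_v f = cst (f v).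
  apply/funext => x; rewrite deriveE; last exact: linear_differentiable.
  by rewrite diff_lin.
exact: Ck_cst.
Qed.

Lemma CkD n F U (f g : 'rV[R]_m -> F) : open U ->
  Ck n U f -> Ck n U g -> Ck n U (f + g).
Proof.
move=> oU; elim: n f g => [|n IHn] f g.
  by move=> cf cg x Ux; apply: continuousD; [exact: cf|exact: cg].
move=> [df Cf] [dg Cg]; split=> [x Ux|v].
  by apply: differentiableD; [apply: df|apply: dg].
apply: (@Ck_ext _ _ _ ('D_v f + 'D_v g)) => //; last exact: (IHn _ _ (Cf v) (Cg v)).
move=> x Ux; have dfx := df x Ux; have dgx := dg x Ux.
by rewrite deriveD //; apply: diff_derivable.
Qed.

Lemma Ck_sum n F U (I : Type) (r : seq I) (f : I -> 'rV[R]_m -> F) : open U ->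
  (forall i, Ck n U (f i)) -> Ck n U (fun x => \sum_(i <- r) f i x).
Proof.
move=> oU Cf; elim: r => [|i r IHr].
  by under eq_fun do rewrite big_nil; apply: Ck_cst.
by under eq_fun do rewrite big_cons; apply: (CkD oU (Cf i) IHr).
Qed.


Lemma Ck_comp_lin n (F G : normedModType R) U (L : {linear F -> G})
    (f : 'rV[R]_m -> F) : open U -> continuous L -> Ck n U f ->
  Ck n U (L \o f).
Proof.
move=> oU cL; elim: n f => [|n IHn] f.
  by move=> cf x Ux; apply: continuous_comp; [exact: cf|exact: cL].
move=> [df Cf]; split=> [x Ux|v].
  by apply: differentiable_comp; [exact: df|exact: linear_differentiable].
apply: (@Ck_ext _ _ _ (L \o 'D_v f)) => //; last exact: (IHn _ (Cf v)).
move=> x Ux; have dL := @linear_differentiable _ _ _ L (f x) cL.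
rewrite [RHS]deriveE; last exact: differentiable_comp (df x Ux) dL.
by rewrite diff_comp //= ?diff_lin //=; [rewrite deriveE //|]; exact: df.
Qed.

Lemma Ck_coord n U p (f : 'rV[R]_m -> 'rV[R]_p) (j : 'I_p) : open U ->
  Ck n U f -> Ck n U (fun x => f x 0 j : R^o).
Proof.
move=> oU Cf.
have lin : linear (fun M : 'rV[R]_p => M 0 j : R^o).
  by move=> a u v; rewrite !mxE.
pose L : {linear _ -> _} := HB.pack (fun M : 'rV[R]_p => M 0 j : R^o)
  (GRing.isLinear.Build _ _ _ _ _ lin).
apply: (@Ck_comp_lin n _ _ U L f) => //.
exact: coord_continuous.
Qed.

Definition scale_fun F (a : R^o) (u : F) : F := a *: u.

Lemma scale_is_bilinear F :
  bilinear_for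
    (GRing.Scale.Law.clone _ _ *:%R _) (GRing.Scale.Law.clone _ _ *:%R _)
    (@scale_fun F).
Proof.
rewrite /scale_fun; by split=> [u|u] a x y /=; [rewrite scalerDl scalerA|
  rewrite scalerDr !scalerA mulrC].
Qed.

HB.instance Definition _ F := bilinear_isBilinear.Build R R^o F F _ _
  (@scale_fun F) (@scale_is_bilinear F).

Lemma is_diff_scale F (a : 'rV[R]_m -> R^o) (f : 'rV[R]_m -> F) x :
  differentiable a x -> differentiable f x ->
  differentiable (fun y => a y *: f y) x /\
  'd (fun y => a y *: f y) x = (fun v => a x *: 'd f x v + 'd a x v *: f x)
    :> (_ -> _).
Proof.
move=> da df.
pose B : {bilinear R^o -> F -> F} := @scale_fun F.
have cB : continuous (fun p => B p.1 p.2).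
  by move=> p; apply: scale_continuous.
have dp : differentiable (fun y => (a y, f y)) x by exact: differentiable_pair.
have dB := differentiable_bilin (a x, f x) cB.
have -> : (fun y => a y *: f y) = (fun p => B p.1 p.2) \o (fun y => (a y, f y)).
  by [].
split; first exact: differentiable_comp.
by rewrite diff_comp // diff_bilin // diff_pair.
Qed.

Lemma CkZ n F U (a : 'rV[R]_m -> R^o) (f : 'rV[R]_m -> F) : open U ->
  Ck n U a -> Ck n U f -> Ck n U (fun x => a x *: f x).
Proof.
move=> oU; elim: n a f => [|n IHn] a f.
  by move=> ca cf x Ux; apply: continuousZ; [exact: ca|exact: cf].
move=> Ca Cf; have [da Da] := Ca; have [df Df] := Cf; split=> [x Ux|v].
  by have [] := is_diff_scale (da x Ux) (df x Ux).
apply: (@Ck_ext _ _ _ ((fun x => a x *: 'D_v f x) + (fun x => 'D_v a x *: f x))).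
- exact: oU.
- move=> x Ux; have [d1 d2] := is_diff_scale (da x Ux) (df x Ux).
  rewrite [RHS]deriveE // d2 /= !fctE /=.
  by rewrite !deriveE //; [exact: da|exact: df].
- apply: CkD => //; first by apply: IHn (Df v); exact: CkW.
  by apply: IHn (Da v) _; exact: CkW.
Qed.

End theory.

Lemma Ck_comp n m p (F : normedModType R) (U : set 'rV[R]_m)
    (U' : set 'rV[R]_p) (f : 'rV[R]_m -> F) (h : 'rV[R]_p -> 'rV[R]_m) :
  open U -> open U' -> (forall x, U' x -> U (h x)) ->
  Ck n U f -> Ck n U' h -> Ck n U' (f \o h).
Proof.
move=> oU oU' hU; elim: n F f h hU => [|n IHn] F f h hU.
  by move=> cf ch x Ux; apply: continuous_comp; [exact: ch|apply: cf; exact: hU].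
move=> Cf Ch; have [df Df] := Cf; have [dh Dh] := Ch; split=> [x Ux|v].
  by apply: differentiable_comp; [exact: (dh x Ux)|exact: (df _ (hU x Ux))].
apply: (@Ck_ext _ _ _ _ (fun x => \sum_(j < m)
    (('D_v h x) 0 j : R^o) *: ('D_(delta_mx 0 j) f \o h) x)) => //.
  move=> x Ux; have dfx := df _ (hU _ Ux); have dhx := dh _ Ux.
  rewrite [RHS]deriveE; last exact: differentiable_comp.
  rewrite diff_comp //= -[X in _ = 'd f _ X]deriveE //.
  rewrite [X in _ = 'd f _ X]row_sum_delta linear_sum /=.
  by apply: eq_bigr => j _; rewrite linearZ /= -(deriveE _ dfx).
apply: Ck_sum => // j; apply: CkZ => //; first exact: (Ck_coord _ oU' (Dh v)).
exact: (IHn _ _ _ hU (Df _) (CkW Ch)).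
Qed.

Lemma Ck_linear n m (F : normedModType R) (U : set 'rV[R]_m)
    (f : {linear 'rV[R]_m -> F}) : open U -> Ck n U f.
Proof.
move=> oU; apply: (@Ck_ext _ _ _ _
    (fun x => \sum_(j < m) (x 0 j : R^o) *: cst (f (delta_mx 0 j)) x)) => //.
  move=> x _; rewrite [X in _ = f X]row_sum_delta linear_sum /=.
  by apply: eq_bigr => j _; rewrite linearZ.
apply: Ck_sum => // j; apply: CkZ => //; last exact: Ck_cst.
apply: (@Ck_coord m n U m id) => //; apply: (@Ck_lin _ _ _ _ idfun).
by move=> x; exact: cvg_id.
Qed.

(* The product U x U' as a subset of R^(m + n). *)
Definition prod_dom m n (U : set 'rV[R]_m) (U' : set 'rV[R]_n) :
  set 'rV[R]_(m + n) := [set w | U (lsubmx w) /\ U' (rsubmx w)].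

Lemma open_prod_dom m n (U : set 'rV[R]_m) (U' : set 'rV[R]_n) :
  open U -> open U' -> open (prod_dom U U').
Proof.
move=> oU oU'; apply: openI.
  by apply: open_comp oU => w _; exact: continuous_lsubmx.
by apply: open_comp oU' => w _; exact: continuous_rsubmx.
Qed.

Lemma smooth_on_local m (F : normedModType R) (U : set 'rV[R]_m)
    (C : set (set 'rV[R]_m)) (f : 'rV[R]_m -> F) :
  U `<=` \bigcup_(A in C) A -> (forall A, C A -> smooth_on A f) ->
  smooth_on U f.
Proof.
move=> UC fC n; elim: n f fC => [|n IHn] f fC.
  by move=> x /UC[A CA Ax]; apply: (fC _ CA 0%N).
split=> [x /UC[A CA Ax]|v]; first by have [df _] := fC _ CA 1%N; exact: df.
by apply: IHn => A CA k; have [_] := fC _ CA k.+1; apply.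
Qed.

End Smooth.

(* A plot U -> X is represented by a total function on 'rV_m, of which only the
   values on U matter ([plot_ext]); nothing is lost, as all the spaces X at hand
   are vector spaces, hence inhabited. *)
Record diffeology (R : realType) (X : Type) := Diffeology {
  plot : forall m : nat, set 'rV[R]_m -> ('rV[R]_m -> X) -> Prop;
  plot_open : forall m (U : set 'rV[R]_m) p, plot U p -> open U;
  plot_ext : forall m (U : set 'rV[R]_m) p p',
    (forall u, U u -> p u = p' u) -> plot U p -> plot U p';
  plot_cst : forall m (U : set 'rV[R]_m) x, open U -> plot U (fun=> x);
  plot_comp : forall m m' (U : set 'rV[R]_m) (U' : set 'rV[R]_m') p h,
    plot U p -> open U' -> (forall u, U' u -> U (h u)) -> smooth_on U' h ->
    plot U' (p \o h);
  plot_cover : forall m (U : set 'rV[R]_m) (C : set (set 'rV[R]_m)) p,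
    (forall A, C A -> open A) -> \bigcup_(A in C) A = U ->
    (forall A, C A -> plot A p) -> plot U p
}.

Section Diffeology.
Context {R : realType}.

Definition dsmooth (X Y : Type) (DX : diffeology R X) (DY : diffeology R Y)
    (f : X -> Y) : Prop :=
  forall m (U : set 'rV[R]_m) p, plot DX U p -> plot DY U (f \o p).

Definition diffeomorphism (X Y : Type) (DX : diffeology R X)
    (DY : diffeology R Y) (f : X -> Y) : Prop :=
  dsmooth DX DY f /\
  exists g : Y -> X, [/\ cancel f g, cancel g f & dsmooth DY DX g].

Section product.
Variables (X1 X2 : Type) (D1 : diffeology R X1) (D2 : diffeology R X2).

Definition prod_plot m (U : set 'rV[R]_m) (p : 'rV[R]_m -> X1 * X2) : Prop :=
  plot D1 U (fst \o p) /\ plot D2 U (snd \o p).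

Program Definition prod_diffeology : diffeology R (X1 * X2) :=
  @Diffeology R (X1 * X2) prod_plot _ _ _ _ _.
Next Obligation. by move=> m U p [/plot_open]. Qed.
Next Obligation.
move=> m U p p' pp' [p1 p2].
by split; [apply: plot_ext p1|apply: plot_ext p2] => u /pp' /= ->.
Qed.
Next Obligation. by move=> m U x oU; split; apply: plot_cst. Qed.
Next Obligation.
move=> m m' U U' p h [p1 p2] oU' hU sh.
by split; [apply: plot_comp p1 _ _ _|apply: plot_comp p2 _ _ _].
Qed.
Next Obligation.
move=> m U C p oC CU pC.
by split; apply: (plot_cover oC CU) => A /pC[].
Qed.

End product.

Section standard.
Variable F : normedModType R.

Definition std_plot m (U : set 'rV[R]_m) (p : 'rV[R]_m -> F) : Prop :=
  open U /\ smooth_on U p.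

(* Used only for the finite-dimensional spaces R^o and 'rV[R]_k. *)
Program Definition std_diffeology : diffeology R F :=
  @Diffeology R F std_plot _ _ _ _ _.
Next Obligation. by move=> m U p []. Qed.
Next Obligation.
by move=> m U p p' pp' [oU sp]; split=> // n; apply: Ck_ext (sp n).
Qed.
Next Obligation. by move=> m U x oU; split=> // n; apply: Ck_cst. Qed.
Next Obligation.
move=> m m' U U' p h [oU sp] oU' hU sh; split=> // n.
exact: (Ck_comp oU oU' hU (sp n) (sh n)).
Qed.
Next Obligation.
move=> m U C p oC <- pC; split; first by apply: bigcup_open => A /oC.
by apply: (@smooth_on_local R m F _ C) => // A /pC[].
Qed.

End standard.

Definition vector_diffeology (V : lmodType R) (D : diffeology R V) : Prop :=
  dsmooth (prod_diffeology D D) D (fun vw => vw.1 + vw.2) /\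
  dsmooth (prod_diffeology (std_diffeology R^o) D) D (fun av => av.1 *: av.2).

Section dual.
Variables (V : vectType R) (D : diffeology R V).

Definition smooth_functional : {pred 'Hom(V, R^o)} :=
  fun f => `[< dsmooth D (std_diffeology R^o) f >].

Lemma smooth_functional_submod_closed : submod_closed smooth_functional.
Proof.
split; first apply/asboolP => m U p Dp.
  apply: plot_ext (plot_cst _ (0 : R^o) (plot_open Dp)) => u _ /=.
  by rewrite zero_lfunE.
move=> a f g /asboolP sf /asboolP sg; apply/asboolP => m U p Dp.
have [oU {}sf] := sf _ _ _ Dp; have [_ {}sg] := sg _ _ _ Dp; split=> // n.
apply: (@Ck_ext _ _ _ _ _ ((fun x => cst (a : R^o) x *: (f (p x))) + (g \o p))).
- exact: oU.
- by move=> x _ /=; rewrite add_lfunE scale_lfunE.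
- by apply: CkD => //; apply: CkZ => //; apply: Ck_cst.
Qed.

HB.instance Definition _ := GRing.isSubmodClosed.Build R 'Hom(V, R^o)
  smooth_functional smooth_functional_submod_closed.

Record dual := Dual {
  dual_fun :> 'Hom(V, R^o);
  dual_smooth : dual_fun \in smooth_functional
}.

HB.instance Definition _ := [isSub for dual_fun].
HB.instance Definition _ := [Choice of dual by <:].
HB.instance Definition _ := [SubChoice_isSubLmodule of dual by <:].

Definition functional_plot m (U : set 'rV[R]_m) (q : 'rV[R]_m -> dual) : Prop :=
  open U /\
  forall n (U' : set 'rV[R]_n) (p : 'rV[R]_n -> V), plot D U' p ->
    smooth_on (prod_dom U U')
      (fun w => (q (lsubmx w) : 'Hom(V, R^o)) (p (rsubmx w))).

Program Definition functional_diffeology : diffeology R dual :=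
  @Diffeology R dual functional_plot _ _ _ _ _.
Next Obligation. by move=> m U p []. Qed.
Next Obligation.
move=> m U q q' qq' [oU sq]; split=> // n U' p Dp k.
apply: Ck_ext (sq _ _ _ Dp k); first exact: open_prod_dom (plot_open Dp).
by move=> w [/qq' -> _].
Qed.
Next Obligation.
move=> m U f oU; split=> // n U' p Dp k.
have /asboolP/(_ _ _ _ Dp)[oU' sf] := dual_smooth f.
have oUU' := open_prod_dom oU oU'.
apply: (@Ck_comp _ _ _ _ _ U' _ (f \o p) rsubmx) => //; first by move=> w [].
exact: Ck_linear.
Qed.
Next Obligation.
move=> m m' U U1 q h [oU sq] oU1 hU sh; split=> // n U' p Dp k.
have oU' := plot_open Dp.
have oUU' := open_prod_dom oU oU'; have oU1U' := open_prod_dom oU1 oU'.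
pose H (w : 'rV[R]_(m' + n)) := row_mx (h (lsubmx w)) (rsubmx w).
apply: (@Ck_ext _ _ _ _ _ ((fun w => (q (lsubmx w) : 'Hom(V, R^o))
    (p (rsubmx w))) \o H)) => //.
  by move=> w _; rewrite /H /= row_mxKl row_mxKr.
apply: (Ck_comp oUU' oU1U' _ (sq _ _ _ Dp k)).
  by move=> w [/hU Uh U'w]; rewrite /H; split; rewrite ?row_mxKl ?row_mxKr.
have lin1 : linear (fun a : 'rV[R]_m => row_mx a (0 : 'rV[R]_n)).
  by move=> a u v; rewrite scale_row_mx add_row_mx scaler0 addr0.
have lin2 : linear (fun b : 'rV[R]_n => row_mx (0 : 'rV[R]_m) b).
  by move=> a u v; rewrite scale_row_mx add_row_mx scaler0 addr0.
pose L1 : {linear _ -> _} := HB.pack (fun a : 'rV[R]_m => row_mx a (0 : 'rV[R]_n))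
  (GRing.isLinear.Build _ _ _ _ _ lin1).
pose L2 : {linear _ -> _} := HB.pack (fun b : 'rV[R]_n => row_mx (0 : 'rV[R]_m) b)
  (GRing.isLinear.Build _ _ _ _ _ lin2).
apply: (@Ck_ext _ _ _ _ _ ((L1 \o (h \o lsubmx)) + (L2 \o rsubmx))) => //.
  by move=> w _; rewrite !fctE /= add_row_mx addr0 add0r.
apply: CkD => //.
  apply: (@Ck_comp _ _ _ _ _ setT _ L1) => //; first exact: openT.
    by apply: Ck_linear; exact: openT.
  apply: (@Ck_comp _ _ _ _ _ U1 _ h) => //; first by move=> w [].
  exact: Ck_linear.
apply: (@Ck_comp _ _ _ _ _ setT _ L2) => //; first exact: openT.
  by apply: Ck_linear; exact: openT.
exact: Ck_linear.
Qed.
Next Obligation.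
move=> m U C q oC CU qC; split.
  by rewrite -CU; apply: bigcup_open => A /oC.
move=> n U' p Dp.
apply: (@smooth_on_local _ _ _ _ [set prod_dom A U' | A in C]).
  rewrite -CU => w [[A CA Aw] U'w].
  by exists (prod_dom A U') => //; exists A.
by move=> _ [A /qC[_ sq] <-]; apply: sq.
Qed.

End dual.

End Diffeology.

(* Main.v *)
(** The smooth functionals form a subspace W of the full linear dual
    [Hom(V, R)]; take coordinates in a basis of W. A linear function on
    [Hom(V, R)] is a combination of evaluations at vectors of V, and evaluation
    at v is smooth on [V^*] because the constant map v is a plot; hence the
    coordinates are smooth. Conversely [(sum_i a_i e_i)(p u)] is smooth in
    [(a, u)], since each basis element [e_i] is a smooth functional. *)
Require Import Defs.
From HB Require Import structures.
From mathcomp Require Import all_boot all_order all_algebra.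
From mathcomp Require Import boolp classical_sets functions reals topology normedtype.

Import GRing.Theory.
Local Open Scope ring_scope.

(** Dimensions of subspaces inside [P] are bounded by that of [E], so one of maximal dimension
    exists; it must exhaust [P]. *)
Lemma submod_closed_vspace {K : fieldType} {E : vectType K} {P : {pred E}} :
  submod_closed P -> exists W : {vspace E}, W =i P.
Proof.
move=> [P0 Plin].
pose dimP n := `[< exists2 W : {vspace E}, \dim W = n & {subset W <= P} >].
have dimP0 : exists n, dimP n.
  exists 0%N; apply/asboolP; exists 0%VS; first exact: dimv0.
  by move=> v; rewrite memv0 => /eqP->.
have dimP_le n : dimP n -> (n <= \dim {:E})%N.
  by move=> /asboolP[W <- _]; apply/dimvS/subvf.
case: (ex_maxnP dimP0 dimP_le) => n /asboolP[W dimW sWP] max_n.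
exists W => v; apply/idP/idP => [/sWP //|Pv].
(* Adjoining the line of [v] stays inside [P], so by maximality it cannot raise the dimension, and
   [v] already lies in [W]. *)
have /max_n : dimP (\dim (W + <[v]>)).
  apply/asboolP; exists (W + <[v]>)%VS => // _ /memv_addP[w Ww [_ /vlineP[a ->] ->]].
  by rewrite addrC; apply: Plin => //; apply: sWP.
rewrite -dimW => le_dim.
have /eqP -> : W == (W + <[v]>)%VS by rewrite eqEdim addvSl.
exact: (subvP (addvSr _ _)) (memv_line v).
Qed.

Section Dual.
Import numFieldNormedType.Exports.
Variables (R : realType) (V : vectType R) (D : diffeology R V).

(** The constant plot at [v] is taken on the one-point space ['rV_0], so that its product with [U]
    is a copy of [U], reached by the linear map [L]. *)
Lemma smooth_on_dual_eval {m : nat} {U : set 'rV[R]_m} {q : 'rV[R]_m -> dual D}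
    (v : V) :
  plot (functional_diffeology D) U q ->
  smooth_on U (fun u => (q u : 'Hom(V, R^o)) v).
Proof.
move=> [oU sq] n.
have lin : linear (fun a : 'rV[R]_m => row_mx a (0 : 'rV[R]_0)).
  by move=> a x y; rewrite scale_row_mx add_row_mx scaler0 addr0.
pose L : {linear _ -> _} := HB.pack (fun a : 'rV[R]_m => row_mx a (0 : 'rV[R]_0))
  (GRing.isLinear.Build _ _ _ _ _ lin).
have Dv : plot D (@setT 'rV[R]_0) (fun=> v) by apply: plot_cst; exact: openT.
have oUT : open (prod_dom U (@setT 'rV[R]_0)).
  by apply: open_prod_dom => //; exact: openT.
apply: (@Ck_ext _ _ _ _ _ ((fun w => (q (lsubmx w) : 'Hom(V, R^o)) v) \o L)) => //.
  by move=> u _ /=; rewrite row_mxKl.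
apply: (Ck_comp oUT oU _ (sq _ _ _ Dv n) (Ck_linear _ L oU)).
by move=> u Uu; split=> //; rewrite /= row_mxKl.
Qed.

(** Expansion in the dual basis: the coefficients are evaluations, which vary smoothly along plots
    of the dual. *)
Lemma lfun_sum_coord (h : 'Hom(V, R^o)) :
  h = \sum_(j < \dim {:V}) h (vbasis {:V})`_j *: linfun (coord (vbasis {:V}) j : V -> R^o).
Proof.
apply/lfunP => v; rewrite sum_lfunE [in LHS](coord_vbasis (memvf v)) linear_sum.
by apply: eq_bigr => j _; rewrite linearZ scale_lfunE lfunE; exact: mulrC.
Qed.

Lemma dsmooth_dual_linear (F : normedModType R) (L : {linear 'Hom(V, R^o) -> F}) :
  dsmooth (functional_diffeology D) (std_diffeology F) (fun h => L (dual_fun h)).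
Proof.
move=> m U q Dq; have oU := plot_open Dq; split=> // n.
pose c (j : 'I_(\dim {:V})) := linfun (coord (vbasis {:V}) j : V -> R^o).
apply: (@Ck_ext _ _ _ _ _ (fun u =>
  \sum_(j < \dim {:V}) ((q u : 'Hom(V, R^o)) (vbasis {:V})`_j : R^o) *: cst (L (c j)) u)) => //.
  move=> u _ /=; rewrite [in RHS](lfun_sum_coord (q u)) linear_sum.
  by apply: eq_bigr => j _; rewrite linearZ.
apply: Ck_sum => // j; apply: CkZ => //; last exact: Ck_cst.
exact: smooth_on_dual_eval.
Qed.

Lemma dual_fun_comb (I : finType) (c : I -> R) (e : I -> dual D) :
  dual_fun (\sum_i c i *: e i) = \sum_i c i *: dual_fun (e i).
Proof.
have -> : dual_fun (\sum_i c i *: e i) = \sum_i dual_fun (c i *: e i).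
  exact: (raddf_sum (val : dual D -> 'Hom(V, R^o))).
by apply: eq_bigr => i _; apply: (@GRing.valZ R _ _ (dual D)).
Qed.

Lemma dsmooth_dual_comb (k : nat) (e : 'I_k -> dual D) :
  dsmooth (std_diffeology 'rV[R]_k) (functional_diffeology D)
    (fun a => \sum_i a 0 i *: e i).
Proof.
move=> m U a [oU sa]; split=> // n U' p Dp N; have oU' := plot_open Dp.
have oUU' := open_prod_dom oU oU'.
(* Each summand is a product of a function of the left block of [w] and one of the right block, both
   pulled back along linear projections. *)
apply: (@Ck_ext _ _ _ _ _ (fun w =>
  \sum_i (a (lsubmx w) 0 i : R^o) *: (e i : 'Hom(V, R^o)) (p (rsubmx w)))) => //.
  move=> w _ /=; rewrite dual_fun_comb sum_lfunE.
  by apply: eq_bigr => i _; rewrite scale_lfunE.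
apply: Ck_sum => // i; apply: CkZ => //.
  apply: (Ck_comp oU oUU' _ (Ck_coord i oU (sa N)) (Ck_linear _ _ _)) => //.
  by move=> w [].
have /asboolP/(_ _ _ _ Dp)[_ se] := dual_smooth (e i).
apply: (Ck_comp oU' oUU' _ (se N) (Ck_linear _ _ _)) => //.
by move=> w [].
Qed.

End Dual.

Theorem theorem2p11 (R : realType) (V : vectType R) (D : diffeology R V)
    (hD : vector_diffeology D) :
  exists (k : nat) (f : {linear dual D -> 'rV[R]_k}),
    diffeomorphism (functional_diffeology D) (std_diffeology 'rV[R]_k) f.
Proof.
have [W WE] := submod_closed_vspace (smooth_functional_submod_closed D).
pose X := vbasis W.
have Xsmooth i : X`_i \in smooth_functional D.
  (* Past the end of [X] the default value 0 is still a smooth functional, so [e] can be indexed by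
     all of [nat]. *)
  have [iX|Xi] := ltnP i (size X); last by rewrite nth_default // rpred0.
  by rewrite -WE; apply/vbasis_mem/mem_nth.
pose e i := Dual (Xsmooth i).
(* [coord X i] is linear on all of ['Hom(V, R^o)], not only on [W], which is what
   [dsmooth_dual_linear] asks for. *)
have lin : linear (fun h : 'Hom(V, R^o) => \row_i coord X i h).
  by move=> a g h; apply/rowP => i; rewrite !mxE linearP.
pose L : {linear _ -> _} := HB.pack (fun h : 'Hom(V, R^o) => \row_i coord X i h)
  (GRing.isLinear.Build _ _ _ _ _ lin).
exists (\dim W), (L \o (val : dual D -> 'Hom(V, R^o))); split.
  exact: dsmooth_dual_linear.
exists (fun a : 'rV_(\dim W) => \sum_(i < \dim W) a 0 i *: e i); split.
- move=> h; apply/val_inj; rewrite /= dual_fun_comb.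
  (* Only for elements of [W] do these coordinates recover the functional; smoothness of [h]
     provides the membership. *)
  have /coord_vbasis {2}-> : dual_fun h \in W by rewrite WE dual_smooth.
  by apply: eq_bigr => i _; rewrite mxE.
- move=> a; apply/rowP => i; rewrite /= dual_fun_comb mxE.
  exact/coord_sum_free/basis_free/vbasisP.
- exact: dsmooth_dual_comb.
Qed.
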